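(* Consider the iterative negotiation and oversight framework described in the context, with tax parameter $\kappa>0$ and asset reserves $R_i>0$. Assume that the asset transfer values are quantized as $|t_j^{(r)}| = c_j^{(r)} b_j$, where $b_j = \frac{1}{\kappa R_j}$ and $c_j^{(r)} \in \mathbb{Z}_{\ge 0}$ denotes the trading quantity in fixed asset units. Then there exists a finite round $\bar r$ such that $c_j^{(r)} \le R_j$ for all $r \ge \bar r$ and all payers $j \in W_r$. Hence the process terminates once all agents satisfy their asset-reserve constraints, i.e., no agent pays more than the amount available in its reserve.
   Context: Agents and costs. $\mathbf{N}=\{1,\dots,n\}$ is the set of agents and $\mathcal{O}$ is a finite set of feasible choices. Agent $i$ has an individual (intrinsic) cost $J_i^{\mathrm{ind}}:\mathcal{O}\to\mathbb{R}$, and $J^{\mathrm{ind}}(o)=[J_1^{\mathrm{ind}}(o),\dots,J_n^{\mathrm{ind}}(o)]^\top$. Agent $i$ has an asset reserve $R_i>0$; $\kappa>0$ is a tax parameter; agent $i$'s valuation of one unit of the traded asset is $b_i=1/(\kappa R_i)$. Put $B_i:=\max_{o,o'\in\mathcal{O}}|J_i^{\mathrm{ind}}(o)-J_i^{\mathrm{ind}}(o')|$ and $B_{\max}:=\max_i B_i$. Rounds. Rounds are indexed $r=1,2,\dots$, with coordination factor $\mathbf{w}^{(r)}\in\mathbb{R}^n_{\ge0}$, $\mathbf{w}^{(1)}=0$. Put $\alpha_r:=\|\mathbf{w}^{(r)}\|_1+1$, $\bar{\mathbf{w}}^{(r)}:=\mathbf{w}^{(r)}/\alpha_r$, $S_v(o):=v^\top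 J^{\mathrm{ind}}(o)$ for $v\in\mathbb{R}^n$, and define the effective cost $J_i^{\mathbf{w}^{(r)}}(o):=S_{\bar{\mathbf{w}}^{(r)}}(o)+\frac{1}{\alpha_r}J_i^{\mathrm{ind}}(o)$. In round $r$: (1) each agent $i$ generates $o_i^{(r)}\in\arg\min_{o\in\mathcal{O}}J_i^{\mathbf{w}^{(r)}}(o)$, and $\mathcal{O}^{(r)}=\{o_1^{(r)},\dots,o_n^{(r)}\}$; (2) the agents run TACo (below) on $\mathcal{O}^{(r)}$ with costs given by the effective costs, yielding the agreed outcome $o_r^{\mathrm{TACo}}\in\mathcal{O}^{(r)}$, payments $P_i$ and offers $O_i$ (in asset units, for the agreed outcome); (3) with $e_i=P_i-O_i$ and shortfall $s_i=\frac{1}{R_i}\max\{0,e_i-R_i\}$, the process terminates if $\sum_i s_i=0$; (4) otherwise $\mathbf{w}^{(r+1)}=\mathbf{w}^{(r)}+\bar s$ with $\bar s_i=s_i/\sum_j s_j$. Hence $\alpha_{r+1}=\alpha_r+1$. TACo (trading auction for consensus). Each agent $i$ has cost $C_{i\ell}$ for option $\ell$, and offer and payment units $O_{i\ell},P_{i\ell}\ge0$, initially zero. Agent $i$'s profit is $b_i(O_{i\ell}-P_{i\ell})-C_{i\ell}$. Agents take turns; the agent $i$ in turn selects a profit-maximizing option $\ell_i^*$, whereupon $P_{i\ell_i^*}$ increases by $nd$ and $O_{j\ell_i^*}$ increases by $d$ for every agent $j$, where $d>0$ is the current trading unit. When a cycle is detected (an agent's profits repeat at two different steps), $d$ is replaced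 by $\gamma d$ with fixed $\gamma\in(0,1)$. The procedure ends when all agents choose the same option or the profit gap among all options in a cycle falls below a tolerance $\varepsilon>0$, at which point a consensus is declared. Transfers. $t_i^{(r)}$ is agent $i$'s transfer value at round $r$, i.e., the value (at its valuation $b_i$) of the net assets it exchanges under $o_r^{\mathrm{TACo}}$. $W_r:=\{i: o_r^{\mathrm{TACo}}\in\arg\min_{o\in\mathcal{O}}J_i^{\mathbf{w}^{(r)}}(o)\}$ is the set of payers. *)

(* Defs.v *)
From HB Require Import structures.
From mathcomp Require Import all_boot all_order all_algebra.
From mathcomp Require Import reals.

Set Implicit Arguments.
Unset Strict Implicit.
Unset Printing Implicit Defensive.

Import Order.TTheory GRing.Theory Num.Theory.
Local Open Scope ring_scope.

(* Agents are the elements of 'I_n, feasible choices those of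
   the finite type O. *)

Record framework (R : realType) (n : nat) (O : finType) := Framework {
  intrinsic_cost : 'I_n -> O -> R;
  reserve : 'I_n -> R;
  tax : R;
  initial_unit : R;  (* trading unit d with which every auction starts *)
  unit_shrink : R;   (* gamma *)
  tolerance : R      (* epsilon *)
}.

Definition argmin (R : realType) (O : finType) (f : O -> R) : {set O} :=
  [set o | [forall o', f o <= f o']].

Section EffectiveCosts.
Variables (R : realType) (n : nat) (O : finType) (F : framework R n O).

Definition l1norm (v : 'cV[R]_n) : R := \sum_i `|v i 0|.

Definition alpha (w : 'cV[R]_n) : R := l1norm w + 1.

Definition normalized (w : 'cV[R]_n) : 'cV[R]_n := (alpha w)^-1 *: w.

Definition social_cost (v : 'cV[R]_n) (o : O) : R :=
  (v^T *m \col_i intrinsic_cost F i o) 0 0.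

Definition effective_cost (w : 'cV[R]_n) (i : 'I_n) (o : O) : R :=
  social_cost (normalized w) o + (alpha w)^-1 * intrinsic_cost F i o.

Definition valuation (i : 'I_n) : R := 1 / (tax F * reserve F i).

End EffectiveCosts.

(* Record of an auction. [offers k], [payments k] and [trade_unit k] are the
   values in force just before the selection made at step k (steps start at 0),
   and [chosen k] is the option selected at that step. Only the entries up to
   the step at which the auction ends are meaningful. *)
Record auction (R : realType) (n : nat) (O : finType) := Auction {
  chosen : nat -> O;
  offers : nat -> 'I_n -> O -> R;
  payments : nat -> 'I_n -> O -> R;
  trade_unit : nat -> R
}.

Section TradingAuction.
Variables (R : realType) (n : nat) (O : finType).
Variables (d0 gamma eps : R) (b : 'I_n -> R).
Variables (X : {set O}) (C : 'I_n -> O -> R) (h : auction R n O).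

Definition profit (k : nat) (i : 'I_n) (l : O) : R :=
  b i * (offers h k i l - payments h k i l) - C i l.

(* The profits of agent i at steps m < k agree, the trading unit having been
   the same for all the selections m, ..., k - 1: repetitions are only sought
   since the last change of unit. *)
Definition profits_repeat (i : 'I_n) (m k : nat) : Prop :=
  [/\ (m < k)%N, trade_unit h m = trade_unit h k.-1
    & forall l, l \in X -> profit m i l = profit k i l].

Definition cycle_detected (k : nat) : Prop :=
  exists i m, profits_repeat i m k.

Definition in_cycle (m k : nat) (l : O) : Prop :=
  exists2 q, (m <= q < k)%N & chosen h q = l.

(* Agents take turns in the order of their indices, so the last n selections
   are the latest selections of all the agents. *)
Definition unanimous (k : nat) (l : O) : Prop :=
  (n <= k)%N /\ forall q, (k - n <= q < k)%N -> chosen h q = l.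

(* The gap is measured with the profits of the agent whose profits repeat; any
   option of the cycle may then be declared. *)
Definition gap_below_tolerance (k : nat) (l : O) : Prop :=
  exists i m, [/\ profits_repeat i m k, in_cycle m k l
    & forall l1 l2, in_cycle m k l1 -> in_cycle m k l2 ->
        profit k i l1 - profit k i l2 < eps].

Definition consensus (k : nat) (l : O) : Prop :=
  unanimous k l \/ (forall l', ~ unanimous k l') /\ gap_below_tolerance k l.

Definition auction_step (k : nat) : Prop :=
  exists i : 'I_n,
    [/\ i = (k %% n)%N :> nat,
        chosen h k \in X /\
          (forall l, l \in X -> profit k i l <= profit k i (chosen h k)),
        forall j l, payments h k.+1 j l = payments h k j l +
          (if (j == i) && (l == chosen h k) then n%:R * trade_unit h k else 0),
        forall j l, offers h k.+1 j l = offers h k j l +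
          (if l == chosen h k then trade_unit h k else 0)
      & (cycle_detected k.+1 -> trade_unit h k.+1 = gamma * trade_unit h k) /\
        (~ cycle_detected k.+1 -> trade_unit h k.+1 = trade_unit h k)].

(* The auction over X ends after K steps, with agreed outcome o. *)
Definition auction_run (K : nat) (o : O) : Prop :=
  [/\ (forall i l, offers h 0 i l = 0 /\ payments h 0 i l = 0),
      trade_unit h 0 = d0,
      forall k, (k < K)%N -> auction_step k,
      forall k l, (k < K)%N -> ~ consensus k l
    & consensus K o].

End TradingAuction.

Record round (R : realType) (n : nat) (O : finType) := Round {
  factor : 'cV[R]_n;
  proposal : 'I_n -> O;
  trading : auction R n O;
  trading_steps : nat;
  outcome : O
}.

Section Negotiation.
Variables (R : realType) (n : nat) (O : finType) (F : framework R n O).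

Implicit Types (rd : round R n O) (rds : nat -> round R n O).

Definition payment rd (i : 'I_n) : R :=
  payments (trading rd) (trading_steps rd) i (outcome rd).

Definition offer rd (i : 'I_n) : R :=
  offers (trading rd) (trading_steps rd) i (outcome rd).

Definition net_payment rd (i : 'I_n) : R := payment rd i - offer rd i.

Definition transfer rd (i : 'I_n) : R :=
  valuation F i * (offer rd i - payment rd i).

Definition payers rd : {set 'I_n} :=
  [set i | outcome rd \in argmin (effective_cost F (factor rd) i)].

Definition shortfall rd (i : 'I_n) : R :=
  (reserve F i)^-1 * Num.max 0 (net_payment rd i - reserve F i).

Definition total_shortfall rd : R := \sum_i shortfall rd i.

Definition normalized_shortfall rd : 'cV[R]_n :=
  \col_i (shortfall rd i / total_shortfall rd).

Definition valid_round rd : Prop :=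
  (forall i, proposal rd i \in argmin (effective_cost F (factor rd) i)) /\
  auction_run (initial_unit F) (unit_shrink F) (tolerance F) (valuation F)
    [set proposal rd i | i : 'I_n] (effective_cost F (factor rd))
    (trading rd) (trading_steps rd) (outcome rd).

(* After a round without shortfall the oversight stops and prescribes no
   update. So that statements about all large rounds are not void for lack of
   rounds, sequences of rounds may be prolonged beyond that point with any
   increment that preserves alpha_{r+1} = alpha_r + 1. *)
Definition factor_update rd (w : 'cV[R]_n) : Prop :=
  if total_shortfall rd != 0 then w = factor rd + normalized_shortfall rd
  else exists v : 'cV[R]_n,
    [/\ forall i, 0 <= v i 0, l1norm v = 1 & w = factor rd + v].

(* Rounds are numbered from 1; [rds 0] is irrelevant. *)
Definition rounds_up_to rds (r : nat) : Prop :=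
  [/\ (0 < r)%N, factor (rds 1) = 0,
      forall q, (0 < q <= r)%N -> valid_round (rds q)
    & forall q, (0 < q < r)%N -> factor_update (rds q) (factor (rds q.+1))].

Definition reached rds (r : nat) : Prop :=
  (0 < r)%N /\ forall q, (0 < q < r)%N -> total_shortfall (rds q) != 0.

(* The process proper, in which a new round is held exactly as long as there
   is a shortfall: the first clause of [factor_update] is the only one used. *)
Definition negotiation rds : Prop :=
  forall r, reached rds r -> rounds_up_to rds r.

Definition terminates_at rds (r : nat) : Prop :=
  reached rds r /\ total_shortfall (rds r) = 0.

End Negotiation.

(* Main.v *)
Require Import Defs.
From mathcomp Require Import all_boot all_order all_algebra.
From mathcomp Require Import reals.
From mathcomp Require Import zify ring lra.
Import Order.TTheory GRing.Theory Num.Theory.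
Local Open Scope ring_scope.

(** In round [r] one has [alpha = r], so the effective costs of any two agents
    agree up to a common term and an error of order [1/r]; hence the proposals,
    each optimal for some agent, have nearly the same cost for every agent.
    Once these gaps are below the value of one trading unit, the unit offered
    by the first agent is decisive for every other agent: all choose the same
    option during the first cycle of turns and the auction ends there, each
    agent having paid [n] units and been offered [n] units. So no assets change
    hands in late rounds. *)

(** * One auction whose cost gaps stay below the value of a trading unit *)

Section CloseCosts.
Set Implicit Arguments.
Unset Strict Implicit.
Variables (R : realType) (n : nat) (O : finType).
Variables (d0 gamma eps : R) (b : 'I_n -> R).
Variables (X : {set O}) (C : 'I_n -> O -> R) (h : auction R n O).
Variables (K : nat) (o : O).
Hypotheses (n_gt0 : (0 < n)%N) (d0_gt0 : 0 < d0) (b_gt0 : forall i, 0 < b i).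
Hypothesis close_costs :
  forall i l l', l \in X -> l' \in X -> C i l - C i l' < b i * d0.
Hypothesis run : auction_run d0 gamma eps b X C h K o.

Let net_offer k i l : R := offers h k i l - payments h k i l.

(** Meant for [k <= n]: after [k] identical selections everyone has been offered [k] units, and the
    agents with index below [k] have had their turn and paid [n] units. *)
Definition first_cycle_offer (k : nat) (i : 'I_n) (l : O) : R :=
  if l == chosen h 0 then (k%:R - (if (i < k)%N then n%:R else 0)) * d0 else 0.

(** All earlier steps are recorded because cycle detection compares with them. The unit is claimed
    only for [k < n]: at step [n] the net offers are back to 0, a cycle is detected and the unit
    shrinks. *)
Definition herding (k : nat) : Prop :=
  [/\ forall m i l, (m <= k)%N -> net_offer m i l = first_cycle_offer m i l,
      forall q, (q < k)%N -> chosen h q = chosen h 0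
    & (k < n)%N -> trade_unit h k = d0].

(** Equal profits on [chosen h 0] would mean equal net offers there, but these differ by [k - m]
    units, corrected by [n] if agent [i] paid in between, and [0 < k - m < n]. *)
Lemma no_repeat_of_herding k i m : chosen h 0 \in X -> (k < n)%N ->
  (forall m' i' l, (m' <= k)%N ->
     net_offer m' i' l = first_cycle_offer m' i' l) ->
  ~ profits_repeat b X C h i m k.
Proof.
move=> X0 kn net [mk _ /(_ _ X0)]; rewrite /profit.
rewrite -/(net_offer m i _) -/(net_offer k i _) !net ?leqnn ?(ltnW mk) //.
move/(addIr _)/(mulfI (lt0r_neq0 (b_gt0 i))).
rewrite /first_cycle_offer eqxx => /(mulIf (lt0r_neq0 d0_gt0)) eq_net.
have: (m + (if (i < k)%N then n else 0) == k + (if (i < m)%N then n else 0))%N.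
  rewrite -(eqr_nat R) !natrD; move: eq_net.
  by case: (i < k)%N; case: (i < m)%N => /= ?; apply/eqP; lra.
by case: ifP; case: ifP => *; lia.
Qed.

Lemma herding_step k : (k < n)%N -> (k < K)%N -> herding k -> herding k.+1.
Proof.
case: run => _ tr0 steps _ _ kn kK [net ch tr].
have [i [ik [chX best] pay off [cyc ncyc]]] := steps k kK.
have chosen0_in : chosen h 0 \in X.
  by have [j [_ [-> _]]] := steps 0%N (leq_ltn_trans (leq0n k) kK).
have chk : chosen h k = chosen h 0.
  have [->//|k_gt0] := posnP k.
  apply/eqP/negPn/negP => neq.
  have := best _ chosen0_in; rewrite /profit -!/(net_offer k i _) !net //.
  rewrite /first_cycle_offer eqxx (negPf neq).
  (* The agent in turn has not paid yet, so [chosen h 0] brings it [k >= 1] units, worth more than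
     any cost advantage of another option. *)
  have -> : (i < k)%N = false by rewrite ik modn_small // ltnn.
  have := close_costs i chosen0_in chX.
  have : b i * d0 <= b i * d0 * k%:R.
    by rewrite ler_peMr ?ler1n // mulr_ge0 // ltW.
  by lra.
have net' m j l : (m <= k.+1)%N -> net_offer m j l = first_cycle_offer m j l.
  rewrite leq_eqVlt => /predU1P [->|]; last by exact: net.
  have -> : net_offer k.+1 j l = net_offer k j l +
      (if l == chosen h k then trade_unit h k else 0) -
      (if (j == i) && (l == chosen h k) then n%:R * trade_unit h k else 0).
    by rewrite /net_offer pay off; ring.
  rewrite net // tr // /first_cycle_offer chk.
  have -> : (j == i) = (j == k :> nat) by rewrite -val_eqE /= ik modn_small.
  case: (l == chosen h 0); rewrite ?andbF ?andbT /=; last by ring.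
  by rewrite ltnS -natr1; case: ltngtP => /= _; ring.
split=> // [q|k1n].
  by rewrite ltnS leq_eqVlt => /predU1P [->|/ch].
rewrite ncyc ?tr // => -[j [m]].
exact: no_repeat_of_herding.
Qed.

Lemma herding_first_cycle k : (k <= n)%N -> (k <= K)%N -> herding k.
Proof.
elim: k => [_ _|k IHk kn kK]; last first.
  by apply: herding_step => //; apply: IHk; apply: ltnW.
case: run => init tr0 _ _ _; split => // m i l.
rewrite leqn0 => /eqP ->; have [off pay] := init i l.
by rewrite /net_offer /first_cycle_offer off pay /= subrr mul0r if_same.
Qed.

(** Before step [n] neither unanimity nor a repetition of profits is possible; at step [n] there is
    unanimity. So [K = n], when payments and offers balance. *)
Lemma no_net_payment_of_close_costs i : payments h K i o - offers h K i o = 0.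
Proof.
have [init tr0 steps ongoing final] := run.
have nK : (n <= K)%N.
  rewrite leqNgt; apply/negP => Kn.
  have [net _ _] := herding_first_cycle (ltnW Kn) (leqnn K).
  case: final => [[]|[_ [j [m [rep [q /andP [mq qK] _] _]]]]].
    by rewrite leqNgt Kn.
  (* The cycle contains a step [q < K], so step 0 was performed and [chosen h 0] lies in [X]. *)
  have [j0 [_ [X0 _] _ _ _]] := steps 0%N (leq_ltn_trans (leq0n q) qK).
  exact: no_repeat_of_herding X0 Kn net rep.
have [net ch _] := herding_first_cycle (leqnn n) nK.
have unan : unanimous h n (chosen h 0).
  by split => // q; rewrite subnn => /andP [_ /ch].
have Kn : K = n.
  apply/eqP; rewrite eqn_leq nK andbT leqNgt; apply/negP => nltK.
  by apply: (ongoing n (chosen h 0) nltK); left.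
have o_chosen : chosen h 0 = o.
  move: final; rewrite Kn => -[[_ -> //]|[/(_ (chosen h 0))//]].
  by rewrite subnn.
apply/eqP; rewrite -oppr_eq0 opprB -/(net_offer K i o) Kn net //.
by rewrite /first_cycle_offer o_chosen eqxx ltn_ord subrr mul0r.
Qed.

End CloseCosts.

(** * The sequence of rounds and its termination *)

Section LateRounds.
Set Implicit Arguments.
Unset Strict Implicit.
Variables (R : realType) (n : nat) (O : finType) (F : framework R n O).
Hypotheses (n_gt0 : (0 < n)%N) (reserve_gt0 : forall i, 0 < reserve F i).
Hypotheses (tax_gt0 : 0 < tax F) (initial_unit_gt0 : 0 < initial_unit F).

Implicit Types (rd : round R n O) (rds : nat -> round R n O).

Lemma valuation_gt0 i : 0 < valuation F i.
Proof. by rewrite divr_gt0 // mulr_gt0. Qed.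

Lemma shortfall_ge0 rd i : 0 <= shortfall F rd i.
Proof. by rewrite mulr_ge0 ?invr_ge0 ?(ltW (reserve_gt0 i)) // le_max lexx. Qed.

(** Nonnegative shortfalls divided by their nonzero sum have l1 norm 1, so both kinds of update take
    the same form. *)
Lemma factor_updateP rd w : factor_update F rd w ->
  exists v : 'cV[R]_n,
    [/\ forall i, 0 <= v i 0, l1norm v = 1 & w = factor rd + v].
Proof.
rewrite /factor_update; case: ifP => // neq0 ->.
have v_ge0 i : 0 <= normalized_shortfall F rd i 0.
  by rewrite mxE divr_ge0 ?sumr_ge0 // => *; exact: shortfall_ge0.
exists (normalized_shortfall F rd); split=> //; rewrite /l1norm.
under eq_bigr => i _ do rewrite ger0_norm // mxE.
by rewrite -mulr_suml divff.
Qed.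

Lemma alpha_round rds r : rounds_up_to F rds r -> alpha (factor (rds r)) = r%:R.
Proof.
case=> r_gt0 w1 _ upd.
(* Nonnegativity joins the induction because it makes the l1 norm additive; the shift is due to
   rounds starting at 1. *)
suff H k : (k < r)%N -> (forall i, 0 <= factor (rds k.+1) i 0) /\
    alpha (factor (rds k.+1)) = k.+1%:R.
  by case: r r_gt0 H {upd} => // r _ /(_ r (ltnSn r)) [].
elim: k => [_|k IHk kr].
  rewrite w1; split=> [i|]; first by rewrite mxE.
  by rewrite /alpha /l1norm big1 ?add0r // => i _; rewrite mxE normr0.
have [w_ge0 alphak] := IHk (ltnW kr).
have [v [v_ge0 v1 ->]] := factor_updateP (upd k.+1 kr).
split=> [i|]; first by rewrite mxE addr_ge0.
rewrite -natr1 -alphak -{}v1 /alpha /l1norm addrAC -big_split /=.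
by congr (_ + _); apply: eq_bigr => i _; rewrite mxE !ger0_norm ?addr_ge0.
Qed.

Definition cost_bound : R := \sum_i \sum_o `|intrinsic_cost F i o|.

Lemma intrinsic_cost_bound i o : `|intrinsic_cost F i o| <= cost_bound.
Proof.
rewrite /cost_bound (bigD1 i) //= (bigD1 o) //= -addrA lerDl.
by rewrite addr_ge0 ?sumr_ge0 // => *; rewrite sumr_ge0.
Qed.

(** The social term is common to [j] and [p], and [p] does not prefer [l']; what remains is four
    intrinsic costs divided by [alpha w]. *)
Lemma optimal_for_other_agent w p j l l' : 0 < alpha w ->
  l \in argmin (effective_cost F w p) ->
  effective_cost F w j l - effective_cost F w j l' <= 4 * cost_bound / alpha w.
Proof.
move=> alpha_gt0; rewrite inE => /forallP /(_ l'); rewrite /effective_cost => opt.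
have bound i o := intrinsic_cost_bound i o.
suff : (alpha w)^-1 *
    (intrinsic_cost F j l - intrinsic_cost F j l' -
     (intrinsic_cost F p l - intrinsic_cost F p l')) <=
    4 * cost_bound / alpha w by lra.
rewrite mulrC ler_pM2r ?invr_gt0 //.
have := bound j l; have := bound j l'; have := bound p l; have := bound p l'.
rewrite !ler_norml => /andP[? ?] /andP[? ?] /andP[? ?] /andP[? ?].
lra.
Qed.

(** The sum over agents stands in for a maximum. Only [F] enters, so the bound is uniform over all
    sequences of rounds. *)
Definition late_round : nat :=
  (Num.trunc (\sum_i 4 * cost_bound / (valuation F i * initial_unit F))).+1.

Lemma no_net_payment_late rds r i : (late_round <= r)%N ->
  rounds_up_to F rds r -> net_payment (rds r) i = 0.
Proof.
move=> late up; have alphar := alpha_round up.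
case: up => r_gt0 _ valid _.
have [prop run] : valid_round F (rds r) by apply: valid; rewrite r_gt0 leqnn.
apply: no_net_payment_of_close_costs run _ => //; first exact: valuation_gt0.
(* Every option on the table is optimal for its proposer [p]. *)
move=> j l l' /imsetP [p _ ->] _.
have r0 : 0 < r%:R :> R by rewrite ltr0n.
have bd_gt0 k : 0 < valuation F k * initial_unit F.
  by rewrite mulr_gt0 ?valuation_gt0.
apply: le_lt_trans (optimal_for_other_agent _ _ _ (prop p)) _; rewrite alphar //.
rewrite ltr_pdivrMr // [ltRHS]mulrC -ltr_pdivrMr //.
have late_r : late_round%:R <= r%:R :> R by rewrite ler_nat.
apply: (le_lt_trans _ (lt_le_trans (truncnS_gt _) late_r)).
rewrite (bigD1 j) //= lerDl sumr_ge0 // => k _.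
rewrite divr_ge0 ?(ltW (bd_gt0 k)) // mulr_ge0 // /cost_bound sumr_ge0 // => *.
by rewrite sumr_ge0.
Qed.

Lemma total_shortfall_eq0 rd : total_shortfall F rd = 0 ->
  forall i, net_payment rd i <= reserve F i.
Proof.
move=> /eqP; rewrite psumr_eq0 => [/allP tot0 i|*]; last exact: shortfall_ge0.
have := tot0 i (mem_index_enum i).
rewrite /= mulf_eq0 invr_eq0 (gt_eqF (reserve_gt0 i)) /= => /eqP max0.
by rewrite -subr_le0 -max0 le_max lexx orbT.
Qed.

(** Take the least round without shortfall before [rbar]; if there is none, [rbar] itself is
    reached. The premise is conditional because a negotiation guarantees valid rounds only as far as
    they are reached. *)
Lemma terminates_of_no_shortfall rds rbar : (0 < rbar)%N ->
  (reached F rds rbar -> total_shortfall F (rds rbar) = 0) ->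
  exists r, terminates_at F rds r.
Proof.
move=> rbar_gt0 no_shortfall.
pose stops r := (0 < r)%N && (total_shortfall F (rds r) == 0).
have [/hasP [r0 _ r0_stops]|/hasPn never] := boolP (has stops (iota 0 rbar)).
  case: (ex_minnP (ex_intro stops r0 r0_stops)) => r /andP [r_gt0 /eqP tot0] r_min.
  exists r; split=> //; split=> // q /andP [q_gt0 qr].
  apply/negP => q0; move: (r_min q).
  by rewrite /stops q_gt0 q0 leqNgt qr => /(_ isT).
have reached_rbar : reached F rds rbar.
  split=> // q /andP [q_gt0 qr].
  by have := never q; rewrite mem_iota qr /stops q_gt0 => /(_ isT).
by exists rbar; split; last exact: no_shortfall.
Qed.

End LateRounds.

Theorem theorem1 (R : realType) (n : nat) (O : finType) (F : framework R n O)
    (n_gt0 : (0 < n)%N)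
    (reserve_gt0 : forall i, 0 < reserve F i)
    (tax_gt0 : 0 < tax F)
    (initial_unit_gt0 : 0 < initial_unit F)
    (unit_shrink_in01 : 0 < unit_shrink F < 1)
    (tolerance_gt0 : 0 < tolerance F) :
  exists rbar : nat,
    forall (rds : nat -> round R n O) (c : nat -> 'I_n -> nat),
      (forall r, rounds_up_to F rds r ->
         forall j, `|transfer F (rds r) j| = (c r j)%:R * valuation F j) ->
      (forall r, (rbar <= r)%N -> rounds_up_to F rds r ->
         forall j, j \in payers F (rds r) -> (c r j)%:R <= reserve F j) /\
      (negotiation F rds ->
         exists r, terminates_at F rds r /\
           forall i, net_payment (rds r) i <= reserve F i).
Proof.
have unpaid := no_net_payment_late n_gt0 reserve_gt0 tax_gt0 initial_unit_gt0.
exists (late_round F) => rds c quantized; split=> [r late up j _|neg].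
  have := quantized r up j.
  have -> : transfer F (rds r) j = 0.
    rewrite /transfer -opprB -/(net_payment (rds r) j).
    by rewrite (unpaid rds r) // oppr0 mulr0.
  (* As the valuation is positive, a zero transfer forces the quantity [c r j] to be 0. *)
  rewrite normr0 => /esym/eqP.
  rewrite mulf_eq0 (gt_eqF (valuation_gt0 reserve_gt0 tax_gt0 j)) orbF.
  by move/eqP ->; rewrite ltW.
have [//|reached_late|r term] := @terminates_of_no_shortfall _ _ _ F rds (late_round F).
  apply: big1 => i _; rewrite /shortfall (unpaid rds (late_round F)) //; last exact: neg.
  by rewrite sub0r max_l ?mulr0 // oppr_le0 ltW.
exists r; split=> //; have [_ tot0] := term.
exact: total_shortfall_eq0.
Qed.
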